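(* Let $f\in\mathcal F$ be nonzero, $\alpha\in\ker f$ and $\beta\in\ker f^\ast$. Then $\langle\alpha,\beta\rangle_f=-\langle\beta,\alpha\rangle_{f^\ast}$.
   Context: Let $p$ be a prime, $q$ a power of $p$, and $C$ an algebraically closed field containing $\mathbb F_q$, complete with respect to a non-archimedean absolute value. $\mathcal F$ is the set of formal sums $f=\sum_{n\in\mathbb Z}a_n\tau^n$ ($a_n\in C$) such that $f(z)=\sum_na_nz^{q^n}$ converges for all $z\in C$; it is a ring under termwise addition and composition $(\sum a_i\tau^i)\circ(\sum b_j\tau^j)=\sum_n(\sum_{i+j=n}a_ib_j^{q^i})\tau^n$ (composition of maps), with $c\in C$ identified with multiplication by $c$. $\ker f=\{z\in C:f(z)=0\}$. The adjoint is $f^\ast=\sum_na_n^{1/q^n}\tau^{-n}$, and $f^{\ast\ast}=f$. For nonzero $f$ and $\alpha\in\ker f$, $g_\alpha\in\mathcal F$ is the unique element with $f\circ\alpha=g_\alpha\circ(1-\tau)$, and $\langle\alpha,\beta\rangle_f=g_\alpha^\ast(\beta)\in\mathbb F_q$ for $\beta\in\ker f^\ast$. *)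

(* Defs.v *)
From HB Require Import structures.
From mathcomp Require Import all_boot all_order all_algebra.
From mathcomp Require Import all_classical all_reals.
Set Implicit Arguments.
Unset Strict Implicit.
Unset Printing Implicit Defensive.
Import Order.TTheory GRing.Theory Num.Theory.
Local Open Scope classical_set_scope.
Local Open Scope ring_scope.

Record nonarch_absval (R : realType) (C : fieldType) := NonarchAbsval {
  absval :> C -> R ;
  absval_ge0 : forall x, 0 <= absval x ;
  absval_eq0 : forall x, absval x = 0 <-> x = 0 ;
  absvalM : forall x y, absval (x * y) = absval x * absval y ;
  absval_ultra : forall x y,
    absval (x + y) <= Num.max (absval x) (absval y) }.

Section Valued.
Context {R : realType} {C : closedFieldType} (v : nonarch_absval R C).

Definition seq_cvg (u : nat -> C) (l : C) : Prop :=
  forall eps : R, 0 < eps ->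
  exists N : nat, forall n : nat, (N <= n)%N -> v (u n - l) < eps.

Definition seq_cauchy (u : nat -> C) : Prop :=
  forall eps : R, 0 < eps ->
  exists N : nat, forall m n : nat, (N <= m)%N -> (N <= n)%N ->
    v (u m - u n) < eps.

Definition complete_absval : Prop :=
  forall u : nat -> C, seq_cauchy u -> exists l : C, seq_cvg u l.

(* A series indexed by the integers converges to [l] when its partial sums over
   [-M, N[ tend to [l] as M and N tend to infinity independently. *)
Definition biseries_cvg (u : int -> C) (l : C) : Prop :=
  forall eps : R, 0 < eps ->
  exists K : nat, forall M N : nat, (K <= M)%N -> (K <= N)%N ->
    v (\sum_(i < M) u (- (i.+1)%:Z) + \sum_(i < N) u i%:Z - l) < eps.

(* The sum of a convergent series; the junk value 0 otherwise. *)
Definition biseries (u : int -> C) : C := xget 0 [set l | biseries_cvg u l].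

Variable q : nat.

(* z^(q^n); for n < 0 it is the root of order q^(-n), which exists because C is
   algebraically closed and is unique when q is a power of the characteristic. *)
Definition qpow (n : int) (z : C) : C :=
  match n with
  | Posz k => z ^+ (q ^ k)%N
  | Negz k => xget 0 [set w | w ^+ (q ^ k.+1)%N = z]
  end.

(* A formal sum of the a_n tau^n is represented by n |-> a_n. *)
Definition fsum := int -> C.

Definition in_F (f : fsum) : Prop :=
  forall z : C, exists l : C, biseries_cvg (fun n => f n * qpow n z) l.

Definition feval (f : fsum) (z : C) : C := biseries (fun n => f n * qpow n z).

Definition fker (f : fsum) : set C := [set z | feval f z = 0].

Definition fcomp (f g : fsum) : fsum :=
  fun n => biseries (fun i => f i * qpow i (g (n - i))).

Definition fconst (c : C) : fsum := fun n => if n == 0 then c else 0.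

Definition ftau : fsum := fun n => if n == 1 then 1 else 0.

Definition one_minus_tau : fsum := fun n => fconst 1 n - ftau n.

(* The coefficient of tau^n in the adjoint is f_(-n)^(q^n). *)
Definition fadj (f : fsum) : fsum := fun n => qpow n (f (- n)).

(* The unique g in F with f o alpha = g o (1 - tau), for alpha in ker f. *)
Definition gquot (f : fsum) (alpha : C) : fsum :=
  xget (fconst 0)
    [set g | in_F g /\ fcomp f (fconst alpha) = fcomp g one_minus_tau].

Definition pairing (f : fsum) (alpha beta : C) : C :=
  feval (fadj (gquot f alpha)) beta.

End Valued.

Arguments fsum : clear implicits.

(* Main.v *)
Require Import Defs.
From HB Require Import structures.
From mathcomp Require Import all_boot all_order all_algebra.
From mathcomp Require Import all_classical all_reals.
From mathcomp Require Import finfield zify ring lra.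
Set Implicit Arguments.
Unset Strict Implicit.
Unset Printing Implicit Defensive.
Import Order.TTheory GRing.Theory Num.Theory.
Local Open Scope ring_scope.

(** Write U(k, m) = (f_(m-k) beta)^(q^k) alpha^(q^m) for integers k and m.
The coefficients of g_alpha are the partial sums of f(alpha), so the pairing of
alpha and beta is the sum over k of the sums of U(k, m) over m <= 0; exchanging
the roles of k and m gives the pairing for f^*.  The array U is not summable on
the quadrant k, m <= 0.  It is summable on the quadrants k > 0 >= m and
k <= 0 < m, however, and since f(alpha) = 0 makes all its rows sum to 0, the
pairing equals the sum of U over the former quadrant minus that over the latter.
The swap of k and m exchanges these two quadrants, whence the sign. *)

(** * Elementary properties of a non-archimedean absolute value *)

Section AbsoluteValue.
Context {R : realType} {C : closedFieldType} (v : nonarch_absval R C).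

Lemma absval0 : v 0 = 0.
Proof. exact/absval_eq0. Qed.

Lemma absval_gt0 x : x != 0 -> 0 < v x.
Proof.
move=> x0; rewrite lt_def absval_ge0 andbT; apply/eqP => /absval_eq0 /eqP.
by rewrite (negbTE x0).
Qed.

Lemma absval1 : v 1 = 1.
Proof.
have v1 : v 1 != 0 by rewrite gt_eqF // absval_gt0 // oner_neq0.
by apply: (mulfI v1); rewrite mulr1 -absvalM mulr1.
Qed.

Lemma absvalX x n : v (x ^+ n) = v x ^+ n.
Proof.
by elim: n => [|n IH]; rewrite ?expr0 ?absval1 // !exprS absvalM IH.
Qed.

Lemma absvalN x : v (- x) = v x.
Proof.
rewrite -mulN1r absvalM; suff -> : v (-1) = 1 by rewrite mul1r.
apply/eqP; rewrite -(@pexpr_eq1 _ _ 2) ?absval_ge0 //.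
by rewrite -absvalX sqrrN expr1n absval1.
Qed.

Lemma absval_add_le x y B : v x <= B -> v y <= B -> v (x + y) <= B.
Proof.
by move=> xB yB; apply: le_trans (absval_ultra _ _ _) _; rewrite ge_max xB.
Qed.

Lemma absval_sub_le x y B : v x <= B -> v y <= B -> v (x - y) <= B.
Proof. by move=> xB yB; apply: absval_add_le; rewrite ?absvalN. Qed.

Lemma absval_sum_le (I : eqType) (t : seq I) (u : I -> C) B : 0 <= B ->
  {in t, forall i, v (u i) <= B} -> v (\sum_(i <- t) u i) <= B.
Proof.
move=> B0 uB; rewrite big_seq.
apply: (big_ind (fun x => v x <= B)) => //; first by rewrite absval0.
by move=> x y; apply: absval_add_le.
Qed.

Lemma absval_small_eq0 x : (forall eps, 0 < eps -> v x <= eps) -> x = 0.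
Proof.
move=> xe; apply/eqP; apply: contraT => /absval_gt0 x0.
by have := xe (v x / 2); lra.
Qed.

(** * Unordered summation over an arbitrary index type *)

Definition vanishing (I : eqType) (u : I -> C) : Prop :=
  forall eps : R, 0 < eps ->
  exists s : seq I, forall i, i \notin s -> v (u i) <= eps.

(** Convergence along the finite subsets of [I]: it depends on no enumeration, so reindexing and
    double sums can be handled directly. *)
Definition has_sum (I : eqType) (u : I -> C) (l : C) : Prop :=
  forall eps : R, 0 < eps ->
  exists s : seq I, forall t : seq I, uniq t -> {subset s <= t} ->
    v (\sum_(i <- t) u i - l) <= eps.

Lemma sum_over_subseq (I : eqType) (u : I -> C) (s t : seq I) :
  uniq t -> {subset s <= t} ->
  \sum_(i <- t) u i =
  \sum_(i <- undup s) u i + \sum_(i <- t | i \notin s) u i.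
Proof.
move=> Ut st; rewrite (bigID (mem s)) /=; congr (_ + _).
rewrite -big_filter; apply/perm_big/uniq_perm.
- exact: filter_uniq.
- exact: undup_uniq.
move=> i; rewrite mem_filter mem_undup /=.
by case: (boolP (i \in s)) => // /st ->.
Qed.

Lemma absval_sum_tail (I : eqType) (u : I -> C) (s t : seq I) eps : 0 < eps ->
  (forall i, i \notin s -> v (u i) <= eps) ->
  uniq t -> {subset s <= t} ->
  v (\sum_(i <- t) u i - \sum_(i <- undup s) u i) <= eps.
Proof.
move=> e0 us Ut st; rewrite (sum_over_subseq u Ut st) addrC addKr -big_filter.
apply: absval_sum_le => [|i]; first exact: ltW.
by rewrite mem_filter => /andP[/us].
Qed.

Lemma absval_sum_dist (I : eqType) (u : I -> C) (s t t' : seq I) eps : 0 < eps ->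
  (forall i, i \notin s -> v (u i) <= eps) ->
  uniq t -> {subset s <= t} -> uniq t' -> {subset s <= t'} ->
  v (\sum_(i <- t) u i - \sum_(i <- t') u i) <= eps.
Proof.
move=> e0 us Ut st Ut' st'.
rewrite -(subrKA (\sum_(i <- undup s) u i)) -[_ - \sum_(i <- t') _]opprB.
exact: absval_sub_le (absval_sum_tail e0 us Ut st)
                     (absval_sum_tail e0 us Ut' st').
Qed.

(** By the ultrametric inequality, two finite sums that both contain all the terms larger than [eps]
    differ by at most [eps]; completeness then supplies the limit. *)
Lemma vanishing_has_sum (I : eqType) (u : I -> C) : complete_absval v ->
  vanishing u -> exists l, has_sum u l.
Proof.
move=> vC u0.
have /choice[s sP] (n : nat) : exists s : seq I,
    forall i, i \notin s -> v (u i) <= n.+1%:R^-1.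
  by apply: u0; rewrite invr_gt0 ltr0n.
(* The union of [s 0], ..., [s n] makes the exceptional sets increasing, so that the sums over [T n]
   form a Cauchy sequence. *)
pose T n := undup (flatten [seq s k | k <- iota 0 n.+1]).
have sT n m : (n <= m)%N -> {subset s n <= T m}.
  move=> nm i i_in; rewrite mem_undup; apply/flattenP; exists (s n) => //.
  by apply: map_f; rewrite mem_iota.
have small eps : 0 < eps -> exists N : nat, N.+1%:R^-1 < eps :> R.
  move=> e0; exists (Num.truncn eps^-1).
  rewrite -[ltRHS]invrK ltf_pV2 ?posrE ?invr_gt0 ?ltr0n //.
  exact: truncnS_gt.
have [eps e0|l ul] := vC (fun n => \sum_(i <- T n) u i).
  have [N Ne] := small _ e0; exists N => m n Nm Nn.
  apply: le_lt_trans Ne; apply: (@absval_sum_dist _ _ (s N)).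
  - by rewrite invr_gt0 ltr0n.
  - exact: sP.
  - exact: undup_uniq.
  - exact: sT.
  - exact: undup_uniq.
  - exact: sT.
exists l => eps e0.
have [N Ne] := small _ e0; have [K Kl] := ul _ e0.
exists (s N) => t Ut st.
(* The index [maxn N K] is large enough both for [T] to contain [s N] and for its sum to be close to
   [l]. *)
have -> : \sum_(i <- t) u i - l =
    (\sum_(i <- t) u i - \sum_(i <- T (maxn N K)) u i) +
    (\sum_(i <- T (maxn N K)) u i - l) by ring.
apply: absval_add_le; last by apply/ltW/Kl; rewrite leq_maxr.
apply: (@absval_sum_dist _ _ (s N)) => //.
- by move=> i /sP => /le_trans; apply; apply: ltW.
- exact: undup_uniq.
- by apply: sT; rewrite leq_maxl.
Qed.

Lemma has_sum_unique (I : eqType) (u : I -> C) l l' :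
  has_sum u l -> has_sum u l' -> l = l'.
Proof.
move=> ul ul'; apply/eqP; rewrite -subr_eq0; apply/eqP/absval_small_eq0 => eps e0.
have [s sl] := ul _ e0; have [s' sl'] := ul' _ e0.
pose t := undup (s ++ s').
have st : {subset s <= t} by move=> i i_in; rewrite mem_undup mem_cat i_in.
have st' : {subset s' <= t} by move=> i i_in; rewrite mem_undup mem_cat i_in orbT.
have -> : l - l' = (\sum_(i <- t) u i - l') - (\sum_(i <- t) u i - l) by ring.
by apply: absval_sub_le; [apply: sl'|apply: sl] => //; apply: undup_uniq.
Qed.

(** The bound [B] itself serves as the precision of the approximating finite sum, so no limit
    argument is needed. *)
Lemma has_sum_le (I : eqType) (u : I -> C) l B :
  0 < B -> has_sum u l -> (forall i, v (u i) <= B) -> v l <= B.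
Proof.
move=> B0 ul uB; have [s sl] := ul _ B0.
have -> : l = \sum_(i <- undup s) u i - (\sum_(i <- undup s) u i - l) by ring.
apply: absval_sub_le; first by apply: absval_sum_le => //; apply: ltW.
by apply: sl; [apply: undup_uniq|move=> j; rewrite mem_undup].
Qed.

Lemma has_sum_ext (I : eqType) (u u' : I -> C) l :
  u =1 u' -> has_sum u l -> has_sum u' l.
Proof. by move/funext ->. Qed.

Lemma has_sumD (I : eqType) (u u' : I -> C) l l' :
  has_sum u l -> has_sum u' l' -> has_sum (fun i => u i + u' i) (l + l').
Proof.
move=> ul ul' eps e0; have [s sl] := ul _ e0; have [s' sl'] := ul' _ e0.
exists (s ++ s') => t Ut st; rewrite big_split /= opprD addrACA.
by apply: absval_add_le; [apply: sl|apply: sl'] => // i i_in;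
  apply: st; rewrite mem_cat i_in ?orbT.
Qed.

Lemma has_sum_morph (h : C -> C) (I : eqType) (u : I -> C) l :
  {morph h : x y / x - y} ->
  (forall eps, 0 < eps -> exists2 d, 0 < d & forall x, v x <= d -> v (h x) <= eps) ->
  has_sum u l -> has_sum (h \o u) (h l).
Proof.
move=> hB hc ul eps e0; have [d d0 hd] := hc _ e0.
have [s sl] := ul _ d0; exists s => t Ut st.
have h0 : h 0 = 0 by have := hB 0 0; rewrite !subrr.
have hD x y : h (x + y) = h x + h y.
  by rewrite -[y in LHS]opprK hB -[- y]sub0r hB h0 sub0r opprK.
by rewrite -(big_morph h hD h0) -hB; apply: hd; apply: sl.
Qed.

Lemma has_sumZ (I : eqType) (u : I -> C) l c :
  has_sum u l -> has_sum (fun i => c * u i) (c * l).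
Proof.
apply: (@has_sum_morph ( *%R c)) => [x y|eps e0]; first by rewrite mulrBr.
have c1 : 0 < v c + 1 by rewrite ltr_wpDl ?absval_ge0.
exists (eps / (v c + 1)) => [|x]; first exact: divr_gt0.
rewrite ler_pdivlMr // => /(le_trans _); apply.
rewrite absvalM mulrC ler_wpM2l ?absval_ge0 // lerDl; exact: ler01.
Qed.

Lemma has_sumN (I : eqType) (u : I -> C) l :
  has_sum u l -> has_sum (fun i => - u i) (- l).
Proof.
move=> /(has_sumZ (-1)); rewrite mulN1r; apply: has_sum_ext => i.
by rewrite mulN1r.
Qed.

Lemma has_sum1 (I : eqType) (u : I -> C) i :
  (forall j, j != i -> u j = 0) -> has_sum u (u i).
Proof.
move=> u0 eps e0; exists [:: i] => t Ut it.
rewrite (bigD1_seq i) //=; last by apply: it; rewrite inE.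
by rewrite big1 // addr0 subrr absval0 ltW.
Qed.

(** This trades a partial sum of a series with sum 0 for the opposite of the complementary tail. *)
Lemma has_sum_restrictC (I : eqType) (P : pred I) (u : I -> C) l :
  has_sum u 0 -> has_sum (fun i => if P i then u i else 0) l ->
  has_sum (fun i => if P i then 0 else u i) (- l).
Proof.
move=> u0 ul; rewrite -[- l]add0r; apply: has_sum_ext (has_sumD u0 (has_sumN ul)).
by move=> i /=; case: ifP; rewrite ?subrr ?subr0.
Qed.

Lemma has_sum_reindex (I J : eqType) (h : I -> J) (u : J -> C) l :
  bijective h -> has_sum u l -> has_sum (u \o h) l.
Proof.
case=> h' hK h'K ul eps e0; have [s sl] := ul _ e0.
exists (map h' s) => t Ut st; rewrite -(big_map h xpredT u); apply: sl.
  by rewrite map_inj_uniq //; apply: can_inj hK.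
by move=> j js; rewrite -(h'K j); apply/map_f/st/map_f.
Qed.

(** Each row is cut to a finite set [w i] that approximates [r i] within [eps] and contains all
    second coordinates of [s]. The cut rows over [t] then cover [s], and the row errors do not
    accumulate in an ultrametric. *)
Lemma has_sum_fubini (I J : eqType) (u : I * J -> C) (r : I -> C) l :
  has_sum u l -> (forall i, has_sum (fun j => u (i, j)) (r i)) -> has_sum r l.
Proof.
move=> ul ur eps e0; have [s sl] := ul _ e0.
have /choice[w wP] i : exists w : seq J, [/\ uniq w, {subset map snd s <= w} &
    v (\sum_(j <- w) u (i, j) - r i) <= eps].
  have [w wr] := ur i _ e0; exists (undup (w ++ map snd s)); split.
  - exact: undup_uniq.
  - by move=> j js; rewrite mem_undup mem_cat js orbT.
  - by apply: wr => [|j jw]; rewrite ?undup_uniq // mem_undup mem_cat jw.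
exists (map fst s) => t Ut st.
pose T := [seq (i, j) | i <- t, j <- w i].
have -> : \sum_(i <- t) r i - l =
    (\sum_(a <- T) u a - l) - \sum_(i <- t) (\sum_(j <- w i) u (i, j) - r i).
  by rewrite big_allpairs_dep /= sumrB; ring.
apply: absval_sub_le; last first.
  by apply: absval_sum_le => [|i _]; [apply: ltW|case: (wP i)].
apply: sl.
  apply: allpairs_uniq_dep => // [i _|[i j] [i' j'] _ _ /= [-> ->] //].
  by case: (wP i).
move=> [i j] ijs; apply/allpairsPdep; exists i, j; split => //.
  by apply: st; apply/mapP; exists (i, j).
by case: (wP i) => _ + _; apply; apply/mapP; exists (i, j).
Qed.

Lemma vanishing_restrict (I : eqType) (P : pred I) (u : I -> C) :
  vanishing u -> vanishing (fun i => if P i then u i else 0).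
Proof.
move=> u0 eps e0; have [s us] := u0 _ e0; exists s => i /us.
by case: ifP => // _ _; rewrite absval0 ltW.
Qed.

Lemma vanishing_reindex (I J : eqType) (h : I -> J) (u : J -> C) :
  bijective h -> vanishing u -> vanishing (u \o h).
Proof.
case=> h' hK h'K u0 eps e0; have [s us] := u0 _ e0; exists (map h' s) => i ns.
by apply: us; apply: contra ns => hs; rewrite -(hK i); apply: map_f.
Qed.

Lemma vanishingB (I : eqType) (u w : I -> C) :
  vanishing u -> vanishing w -> vanishing (fun i => u i - w i).
Proof.
move=> u0 w0 eps e0; have [s us] := u0 _ e0; have [t wt] := w0 _ e0.
exists (s ++ t) => i; rewrite mem_cat negb_or => /andP[/us ? /wt ?].
exact: absval_sub_le.
Qed.

(** * Comparison with two-sided series indexed by the integers *)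

Lemma vanishing_intP (u : int -> C) : vanishing u <->
  forall eps : R, 0 < eps ->
  exists N : nat, forall n : nat, (N <= n)%N ->
    v (u n%:Z) <= eps /\ v (u (- n%:Z)) <= eps.
Proof.
split=> u0 eps e0.
  have [s su] := u0 _ e0; exists (\max_(i <- s) `|i|%N).+1 => n sn.
  have nin i : `|i|%N = n -> i \notin s.
    move=> ni; apply: contraL sn => si; rewrite -leqNgt -ni.
    exact: (@leq_bigmax_seq _ _ xpredT (fun i : int => `|i|%N)).
  by split; apply/su/nin; rewrite ?abszN.
have [N uN] := u0 _ e0.
exists (map Posz (iota 0 N) ++ map (fun n => - n%:Z) (iota 0 N)) => i iN.
have {iN} Ni : (N <= `|i|)%N.
  rewrite leqNgt; apply: contra iN => iN; rewrite mem_cat; apply/orP.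
  by have [i0|i0] := leP 0 i; [left|right]; apply/mapP; exists `|i|%N;
    rewrite ?mem_iota //; lia.
have [uP uM] := uN _ Ni.
have [i0|i0] := leP 0 i.
  by have <- : `|i|%N%:Z = i by lia.
by have <- : - `|i|%N%:Z = i by lia.
Qed.

Lemma has_sum_biseries_cvg (u : int -> C) l : has_sum u l -> biseries_cvg v u l.
Proof.
(* Halving [eps] turns the weak inequality of [has_sum] into the strict one of [biseries_cvg]. *)
move=> ul eps e0; have [|s sl] := ul (eps / 2); first by lra.
exists (\max_(i <- s) `|i|%N).+1 => M N sM sN.
apply: (@le_lt_trans _ _ (eps / 2)); last by lra.
pose t := map (fun i => - (i.+1)%:Z) (iota 0 M) ++ map Posz (iota 0 N).
have -> : \sum_(i < M) u (- (i.+1)%:Z) + \sum_(i < N) u i%:Z = \sum_(i <- t) u i.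
  rewrite big_cat !big_map /= -(big_mkord xpredT (fun i => u (- i.+1%:Z))).
  by rewrite -(big_mkord xpredT (fun i => u i%:Z)) /index_iota !subn0.
apply: sl.
  rewrite cat_uniq !map_inj_uniq ?iota_uniq /= ?andbT; try by move=> ? ?; lia.
  by apply/hasPn => i /mapP[n _ ->]; apply/negP => /mapP[m _]; lia.
move=> i si; have {}si := @leq_bigmax_seq _ _ xpredT (fun i => `|i|%N) _ si isT.
rewrite mem_cat; apply/orP; have [i0|i0] := leP 0 i; [right|left]; apply/mapP.
  by exists `|i|%N; rewrite ?mem_iota; lia.
by exists `|i|%N.-1; rewrite ?mem_iota; lia.
Qed.

Lemma biseries_cvg_unique (u : int -> C) l l' :
  biseries_cvg v u l -> biseries_cvg v u l' -> l = l'.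
Proof.
move=> ul ul'; apply/eqP; rewrite -subr_eq0; apply/eqP/absval_small_eq0 => eps e0.
have [K Kl] := ul _ e0; have [K' Kl'] := ul' _ e0.
have := Kl (maxn K K') (maxn K K'); have := Kl' (maxn K K') (maxn K K').
rewrite !leq_maxl !leq_maxr; set S := \sum_(i < _) _ + _.
move=> /(_ isT isT) h' /(_ isT isT) h.
have -> : l - l' = (S - l') - (S - l) by ring.
by apply: absval_sub_le; apply: ltW.
Qed.

Lemma biseriesE (u : int -> C) l : has_sum u l -> biseries v u = l.
Proof.
move=> /has_sum_biseries_cvg ul; apply: xget_unique => // l' /= ul'.
exact: biseries_cvg_unique ul' ul.
Qed.

(** Each term is a difference of two consecutive partial sums whose other end is fixed at [K]; this
    uses that the two ends move independently. *)
Lemma biseries_cvg_vanishing (u : int -> C) l :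
  biseries_cvg v u l -> vanishing u.
Proof.
move=> ul; apply/vanishing_intP => eps e0; have [K Kl] := ul _ e0.
(* Starting at [K.+1] excludes 0, so the index is a successor, matching the enumeration of negative
   indices as [- n.+1]. *)
exists K.+1 => -[//|n] Kn; split.
  have h1 := Kl K n.+1 (leqnn _) (leqW Kn).
  have h2 := Kl K n.+2 (leqnn _) (leqW (leqW Kn)).
  move: h2; rewrite big_ord_recr /=; move: h1; set S := \sum_(i < n.+1) _.
  set S' := \sum_(i < K) _; set x := u _ => h1 h2.
  have -> : x = (S' + (S + x) - l) - (S' + S - l) by ring.
  by apply: absval_sub_le; apply: ltW.
have h1 := Kl n K Kn (leqnn _).
have h2 := Kl n.+1 K (leqW Kn) (leqnn _).
move: h2; rewrite big_ord_recr /=; move: h1; set S := \sum_(i < n) _.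
set S' := \sum_(i < K) _; set x := u _ => h1 h2.
have -> : x = (S + x + S' - l) - (S + S' - l) by ring.
by apply: absval_sub_le; apply: ltW.
Qed.

Lemma biseries_cvg_has_sum (u : int -> C) l : complete_absval v ->
  biseries_cvg v u l -> has_sum u l.
Proof.
move=> vC ul; have [l' ul'] := vanishing_has_sum vC (biseries_cvg_vanishing ul).
by rewrite (biseries_cvg_unique ul (has_sum_biseries_cvg ul')).
Qed.

End AbsoluteValue.

(** * Integer powers of the Frobenius map *)

Section FormalSums.
Context {R : realType} {C : closedFieldType} (v : nonarch_absval R C).
Variable q : nat.
Hypothesis q_pchar : [pchar C].-nat q.

Let q_gt0 : (0 < q)%N.
Proof. by case/andP: q_pchar. Qed.

Let qX_gt0 k : (0 < q ^ k)%N.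
Proof. by rewrite expn_gt0 q_gt0. Qed.

Let exprB_qX k (x y : C) : (x - y) ^+ (q ^ k) = x ^+ (q ^ k) - y ^+ (q ^ k).
Proof.
have qk : [pchar C].-nat (q ^ k)%N by rewrite pnatX q_pchar.
apply/eqP; rewrite eq_sym subr_eq; apply/eqP.
by rewrite -(exprDn_pchar _ _ qk) subrK.
Qed.

Let expr_qX_inj k : injective (fun x : C => x ^+ (q ^ k)).
Proof.
move=> x y /eqP; rewrite -subr_eq0 -exprB_qX expf_eq0 qX_gt0 /= subr_eq0.
by move/eqP.
Qed.

Let exists_root (z : C) (n : nat) : (0 < n)%N -> exists x, x ^+ n = z.
Proof.
case: n => // n n0; have [x xP] := solve_monicpoly (fun i => if i == 0 then z else 0) n0.
exists x; rewrite xP big_ord_recl big1 /= ?addr0 ?expr0 ?mulr1 // => i _.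
by rewrite mul0r.
Qed.

(** This hides the choice of a root: since raising to the power [q ^ j] is injective, identities
    about [qpow] reduce to identities between natural powers. *)
Lemma qpow_expr (n : int) (i j : nat) (z : C) :
  n + j%:Z = i%:Z -> qpow q n z ^+ (q ^ j) = z ^+ (q ^ i).
Proof.
case: n => k ijk /=; rewrite -?exprM -?expnD; first by congr (_ ^+ (_ ^ _)); lia.
have -> : j = (k.+1 + i)%N by lia.
rewrite expnD exprM; congr (_ ^+ _).
have [w wz] := exists_root z (qX_gt0 k.+1).
exact: (@xgetI _ 0 [set w | w ^+ (q ^ k.+1)%N = z]%classic w wz).
Qed.

Let int_sub_nat (n : int) : exists i j : nat, n + j%:Z = i%:Z.
Proof. by exists (absz (n + `|n|%N%:Z)), (absz n); lia. Qed.

Lemma qpowB n : {morph @qpow C q n : x y / x - y}.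
Proof.
move=> x y; have [i [j ij]] := int_sub_nat n; apply: (@expr_qX_inj j).
by rewrite exprB_qX !(qpow_expr _ ij) exprB_qX.
Qed.

Lemma qpowM n : {morph @qpow C q n : x y / x * y}.
Proof.
move=> x y; have [i [j ij]] := int_sub_nat n; apply: (@expr_qX_inj j).
by rewrite exprMn !(qpow_expr _ ij) exprMn.
Qed.

Lemma qpow_add m n (z : C) : qpow q (m + n) z = qpow q m (qpow q n z).
Proof.
have [i [j ij]] := int_sub_nat m; have [i' [j' ij']] := int_sub_nat n.
apply: (@expr_qX_inj (j + j')).
rewrite (@qpow_expr _ (i + i') _); last by rewrite !PoszD -ij -ij'; ring.
rewrite [in RHS]expnD [in RHS]exprM (qpow_expr _ ij) exprAC (qpow_expr _ ij') -exprM.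
by rewrite -expnD addnC.
Qed.

Lemma qpow0n n : qpow q n 0 = 0 :> C.
Proof. by have := qpowB n 0 0; rewrite !subrr. Qed.

Lemma qpow1n n : qpow q n 1 = 1 :> C.
Proof.
have [i [j ij]] := int_sub_nat n; apply: (@expr_qX_inj j).
by rewrite (qpow_expr _ ij) !expr1n.
Qed.

Lemma qpowN n (z : C) : qpow q n (- z) = - qpow q n z.
Proof. by rewrite -sub0r qpowB qpow0n sub0r. Qed.

Lemma absval_qpow_nat (k : nat) z : v (qpow q k%:Z z) = v z ^+ (q ^ k).
Proof. exact: absvalX. Qed.

Lemma absval_qpow_oppn (k : nat) z : v (qpow q (- k%:Z) z) ^+ (q ^ k) = v z.
Proof. by rewrite -absvalX (@qpow_expr _ 0) ?expr1 //; lia. Qed.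

(** Powers preserve balls of radius at most 1, and roots those of radius at least 1. Hence the later
    bounds capped at 1 or enlarged to [v z + 1]. *)
Lemma absval_qpow_pos_le n z d : 0 <= n -> d <= 1 -> v z <= d -> v (qpow q n z) <= d.
Proof.
case: n => // k _ d1 zd; rewrite absval_qpow_nat (le_trans _ zd) //.
by rewrite ler_iXnr ?absval_ge0 // (le_trans zd).
Qed.

Lemma absval_qpow_neg_le n z d : n <= 0 -> 1 <= d -> v z <= d -> v (qpow q n z) <= d.
Proof.
move=> n0 d1 zd; have -> : n = - `|n|%N%:Z by lia.
rewrite -(@ler_pXn2r _ (q ^ `|n|)) ?nnegrE ?absval_ge0 ?absval_qpow_oppn //; last by lra.
by rewrite (le_trans zd) // ler_eXnr.
Qed.

Lemma absval_qpow_cont n eps : 0 < eps ->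
  exists2 d, 0 < d & forall z, v z <= d -> v (qpow q n z) <= eps.
Proof.
move=> e0; have [n0|n0] := leP 0 n.
  exists (Num.min 1 eps) => [|z zd]; first by rewrite lt_min ltr01.
  apply: (@le_trans _ _ (Num.min 1 eps)); last by rewrite ge_min lexx orbT.
  by apply: absval_qpow_pos_le; rewrite // ge_min lexx.
exists (eps ^+ (q ^ `|n|)) => [|z]; first exact: exprn_gt0.
have {2}-> : n = - `|n|%N%:Z by lia.
by rewrite -{1}(absval_qpow_oppn `|n| z) ler_pXn2r ?nnegrE ?absval_ge0 // ltW.
Qed.

Lemma has_sum_qpow (I : eqType) (u : I -> C) l n :
  has_sum v u l -> has_sum v (fun i => qpow q n (u i)) (qpow q n l).
Proof.
by apply: has_sum_morph => [|eps]; [apply: qpowB|apply: absval_qpow_cont].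
Qed.

(** * Membership in the ring as decay of the coefficients *)

(** A root-free way to say that the root of order [q ^ n] of [v (f n)] tends to 0. *)
Definition decay_pos (f : fsum C) : Prop :=
  forall eps : R, 0 < eps ->
  exists N : nat, forall n : nat, (N <= n)%N -> v (f n%:Z) <= eps ^+ (q ^ n).

Definition decay_neg (f : fsum C) : Prop :=
  forall eps : R, 0 < eps ->
  exists N : nat, forall n : nat, (N <= n)%N -> v (f (- n%:Z)) <= eps.

Lemma in_F_vanishing f z : in_F v q f -> vanishing v (fun n => f n * qpow q n z).
Proof. by move=> /(_ z)[l /biseries_cvg_vanishing]. Qed.

Lemma in_F_decay_neg f : in_F v q f -> decay_neg f.
Proof.
move=> fF eps e0; have /vanishing_intP/(_ _ e0)[N fN] := in_F_vanishing 1 fF.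
by exists N => n /fN[_]; rewrite qpow1n mulr1.
Qed.

Let exists_large_expr (x y : R) : 1 < x -> exists n : nat, y <= x ^+ n.
Proof.
move=> x1; exists (Num.truncn (y / (x - 1))).+1.
have x0 : 0 < x - 1 by lra.
(* A weak form of Bernoulli's inequality. *)
have bern n : n%:R * (x - 1) <= x ^+ n.
  elim: n => [|n IH]; first by rewrite mul0r expr0 ler01.
  have : 1 <= x ^+ n by rewrite exprn_ege1 // ltW.
  rewrite exprS -natr1; nra.
apply: le_trans (bern _); rewrite -ler_pdivrMr //; apply: ltW; exact: truncnS_gt.
Qed.

(* The case split is needed because C only has elements of large absolute value
   when v is nontrivial. *)
Lemma in_F_decay_pos f : in_F v q f -> decay_pos f.
Proof.
move=> fF eps e0; have [[w w1]|triv] := pselect (exists w, 1 < v w).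
  (* Convergence is tested at [w ^+ j], of absolute value at least [eps^-1]. *)
  have [j wj] := exists_large_expr eps^-1 w1.
  have /vanishing_intP/(_ _ ltr01)[N fN] := in_F_vanishing (w ^+ j) fF.
  exists N => n /fN[+ _]; rewrite absvalM absval_qpow_nat absvalX => h.
  have wn : (eps^-1) ^+ (q ^ n) <= (v w ^+ j) ^+ (q ^ n).
    by rewrite lerXn2r // ?nnegrE ?exprn_ge0 ?absval_ge0 // invr_ge0 ltW.
  have := le_trans (ler_wpM2l (absval_ge0 v (f n)) wn) h.
  by rewrite exprVn ler_pdivrMr ?exprn_gt0 // mul1r.
(* No absolute value exceeds 1 here, so by taking inverses nonzero elements have absolute value 1; a
   coefficient bounded by 1/2 must be 0. *)
have half0 : 0 < 2^-1 :> R by lra.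
have /vanishing_intP/(_ _ half0)[N fN] := in_F_vanishing 1 fF.
exists N => n /fN[+ _]; rewrite qpow1n mulr1 => h.
have [->|/eqP fn0] := pselect (f n = 0); first by rewrite absval0 exprn_ge0 // ltW.
case: triv; exists (f n)^-1.
have := absval_gt0 v fn0; have := absvalM v (f n) (f n)^-1.
by rewrite divff // absval1; nra.
Qed.

Lemma decay_vanishing f z : decay_pos f -> decay_neg f ->
  vanishing v (fun n => f n * qpow q n z).
Proof.
move=> fP fN; apply/vanishing_intP => eps e0.
have z0 := absval_ge0 v z.
have z1 : 0 < v z + 1 by lra.
(* With a base at most 1, raising to the power [q ^ n] cannot increase it. *)
pose d := Num.min 1 eps.
have d0 : 0 < d by rewrite lt_min ltr01.
have d1 : d <= 1 by rewrite ge_min lexx.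
have [N1 fN1] := fP (d / (v z + 1)) (divr_gt0 d0 z1).
have [N2 fN2] := fN (eps / (v z + 1)) (divr_gt0 e0 z1).
exists (maxn N1 N2) => n; rewrite geq_max => /andP[/fN1 h1 /fN2 h2]; split.
  rewrite absvalM absval_qpow_nat.
  apply: (@le_trans _ _ d); last by rewrite ge_min lexx orbT.
  apply: (@le_trans _ _ ((d / (v z + 1) * v z) ^+ (q ^ n))).
    by rewrite exprMn ler_wpM2r // exprn_ge0.
  have dz : d / (v z + 1) * v z <= d.
    by rewrite mulrAC ler_pdivrMr // ler_wpM2l ?ltW //; lra.
  apply: le_trans dz; rewrite ler_iXnr //.
    by rewrite mulr_ge0 // ltW // divr_gt0.
  by rewrite mulrAC ler_pdivrMr // mul1r; nra.
rewrite absvalM; have : v (qpow q (- n%:Z) z) <= v z + 1.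
  by apply: absval_qpow_neg_le; [lia|lra|lra].
have -> : eps = eps / (v z + 1) * (v z + 1) by rewrite divfK // gt_eqF.
by move=> h3; apply: ler_pM => //; apply: absval_ge0.
Qed.

Lemma decay_in_F f : complete_absval v -> decay_pos f -> decay_neg f -> in_F v q f.
Proof.
move=> vC fP fN z; have [l fl] := vanishing_has_sum vC (decay_vanishing z fP fN).
by exists l; apply: has_sum_biseries_cvg.
Qed.

(** The adjoint exchanges the two decay conditions. *)
Lemma in_F_fadj f : complete_absval v -> in_F v q f -> in_F v q (fadj q f).
Proof.
move=> vC fF; apply: decay_in_F => // eps e0.
  have [N fN] := in_F_decay_neg fF e0; exists N => n /fN h.
  by rewrite absval_qpow_nat lerXn2r ?nnegrE ?absval_ge0 // ltW.
have [N fN] := in_F_decay_pos fF e0; exists N => n /fN h.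
rewrite /fadj opprK -(@ler_pXn2r _ (q ^ n)) ?nnegrE ?absval_ge0 ?absval_qpow_oppn //.
exact: ltW.
Qed.

(** * Right division by [one_minus_tau] *)

Lemma fcomp_fconst f a : fcomp v q f (fconst a) = fun n => f n * qpow q n a.
Proof.
apply/funext => n; apply: biseriesE.
have -> : f n * qpow q n a = (fun i => f i * qpow q i (fconst a (n - i))) n.
  by rewrite /fconst subrr.
apply: has_sum1 => i ni; rewrite /fconst subr_eq0 eq_sym (negbTE ni).
by rewrite qpow0n mulr0.
Qed.

Lemma fcomp_one_minus_tau g :
  fcomp v q g one_minus_tau = fun n => g n - g (n - 1).
Proof.
apply/funext => n; apply: biseriesE.
pose u i := if i == n then g i else 0.
pose w i := if i == n - 1 then - g i else 0.
have un : has_sum v u (g n).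
  have -> : g n = u n by rewrite /u eqxx.
  by apply: has_sum1 => i /negbTE; rewrite /u => ->.
have wn : has_sum v w (- g (n - 1)).
  have -> : - g (n - 1) = w (n - 1) by rewrite /w eqxx.
  by apply: has_sum1 => i /negbTE; rewrite /w => ->.
apply: has_sum_ext (has_sumD un wn) => i.
rewrite /u /w /one_minus_tau /fconst /ftau.
have -> : (n - i == 0) = (i == n) by lia.
have -> : (n - i == 1) = (i == n - 1) by lia.
have [->|_] := eqVneq i n.
  have -> : (n == n - 1) = false by lia.
  by rewrite subr0 qpow1n mulr1 addr0.
have [->|_] := eqVneq i (n - 1); first by rewrite !sub0r qpowN qpow1n mulrN1.
by rewrite subrr qpow0n mulr0 addr0.
Qed.

Lemma fker_has_sum f a : complete_absval v -> in_F v q f -> fker v q f a ->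
  has_sum v (fun n => f n * qpow q n a) 0.
Proof.
move=> vC fF fa; have [l /(biseries_cvg_has_sum vC) fl] := fF a.
by move: fa; rewrite /fker /feval /= (biseriesE fl) => <-.
Qed.

(* The coefficients of f a / (1 - tau) are the partial sums of f(a). *)
Lemma in_F_partial_sums f a b : complete_absval v -> in_F v q f -> fker v q f a ->
  (forall n, has_sum v (fun i => if i <= n then f i * qpow q i a else 0) (b n)) ->
  in_F v q b.
Proof.
move=> vC fF fa bP; have tot := fker_has_sum vC fF fa.
have a0 := absval_ge0 v a.
have a1 : 0 < v a + 1 by lra.
apply: decay_in_F => // eps e0.
  pose d := Num.min 1 eps.
  have d0 : 0 < d by rewrite lt_min ltr01.
  have d1 : d <= 1 by rewrite ge_min lexx.
  have [N fN] := in_F_decay_pos fF (divr_gt0 d0 a1).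
  (* Since the whole series sums to 0, [- b n] is the sum of the terms of index greater than [n].
     Each is at most [d ^+ (q ^ k)] with [k] at least [n], hence at most [d ^+ (q ^ n)] because
     [d <= 1]. *)
  exists N => n Nn; rewrite -absvalN.
  apply: (@le_trans _ _ (d ^+ (q ^ n))); last first.
    by rewrite lerXn2r ?nnegrE ?(ltW d0) ?(ltW e0) // ge_min lexx orbT.
  apply: (has_sum_le _ (has_sum_restrictC tot (bP n%:Z))) => [|i].
    exact: exprn_gt0.
  case: ifP => [_|ni]; first by rewrite absval0 exprn_ge0 // ltW.
  have {ni} [k -> nk] : exists2 k : nat, i = k%:Z & (n <= k)%N.
    by exists `|i|%N; lia.
  rewrite absvalM absval_qpow_nat.
  apply: (@le_trans _ _ ((d / (v a + 1) * v a) ^+ (q ^ k))).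
    by rewrite exprMn ler_wpM2r ?exprn_ge0 // fN // (leq_trans Nn).
  apply: (@le_trans _ _ (d ^+ (q ^ k))).
    rewrite lerXn2r ?nnegrE ?(ltW d0) //.
      by rewrite mulr_ge0 // ltW // divr_gt0.
    by rewrite mulrAC ler_pdivrMr // ler_wpM2l ?ltW //; lra.
  by rewrite ler_wiXn2l ?(ltW d0) // leq_pexp2l.
have /vanishing_intP/(_ _ e0)[N fN] := in_F_vanishing a fF.
exists N => n Nn; apply: (has_sum_le e0 (bP _)) => i.
case: ifP => [ni|_]; last by rewrite absval0 ltW.
have -> : i = - `|i|%N%:Z by lia.
by apply: (fN `|i|%N _).2; lia.
Qed.

(** The partial sums solve the defining equation by telescoping. They are the only solution in the
    ring: the difference of two solutions has constant coefficients, which tend to 0 at minus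
    infinity. *)
Lemma gquot_has_sum f a : complete_absval v -> in_F v q f -> fker v q f a ->
  forall n, has_sum v (fun i => if i <= n then f i * qpow q i a else 0)
                    (gquot v q f a n).
Proof.
move=> vC fF fa.
have /choice[b bP] n : exists l,
    has_sum v (fun i => if i <= n then f i * qpow q i a else 0) l.
  exact/(vanishing_has_sum vC)/vanishing_restrict/in_F_vanishing.
suff -> : gquot v q f a = b by [].
have bF := in_F_partial_sums vC fF fa bP.
have bE n : b n - b (n - 1) = f n * qpow q n a.
  apply: has_sum_unique (has_sumD (bP n) (has_sumN (bP (n - 1)))) _.
  pose u i := if i == n then f i * qpow q i a else 0.
  have -> : f n * qpow q n a = u n by rewrite /u eqxx.
  apply: (@has_sum_ext _ _ _ _ u) => [i|]; last first.
    by apply: has_sum1 => i /negbTE; rewrite /u => ->.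
  rewrite /u; have [->|ni] := eqVneq i n.
    by rewrite lexx ifF ?subr0 //; lia.
  have -> : (i <= n - 1) = (i <= n) by lia.
  by case: ifP; rewrite subrr.
apply: xget_unique => [|g [gF gE]].
  by split=> //; rewrite fcomp_fconst fcomp_one_minus_tau; apply/funext => n; rewrite bE.
pose d n := g n - b n.
have dE n : d n = d (n - 1).
  move: gE; rewrite fcomp_fconst fcomp_one_minus_tau => /(congr1 (fun h => h n)).
  rewrite -bE /d => /eqP; rewrite subr_eq => /eqP ->; ring.
have dN n (k : nat) : d n = d (n - k%:Z).
  elim: k => [|k IH]; first by rewrite subr0.
  by rewrite IH dE; congr d; lia.
apply/funext => n; apply/eqP; rewrite -subr_eq0; apply/eqP.
apply: (@absval_small_eq0 _ _ v) => eps e0.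
have [N1 gN] := in_F_decay_neg gF e0; have [N2 bN] := in_F_decay_neg bF e0.
(* The shift by [|n|] absorbs a positive [n], so the new index is at most [- maxn N1 N2]. *)
rewrite -/(d n) (dN n (`|n| + maxn N1 N2)%N).
have [k -> Nk] : exists2 k : nat, n - (`|n| + maxn N1 N2)%N%:Z = - k%:Z &
    (maxn N1 N2 <= k)%N.
  by exists (absz (n - (`|n| + maxn N1 N2)%N%:Z)); lia.
by apply: absval_sub_le; [apply: gN|apply: bN]; lia.
Qed.

(** * The double array and its antisymmetry *)

Definition pairing_term (f : fsum C) (a b : C) (km : int * int) : C :=
  qpow q km.1 (f (km.2 - km.1) * b) * qpow q km.2 a.

(** The signs merge the difference of the two quadrant sums into a single sum over all pairs of
    integers, to which Fubini applies. *)
Definition signed_pairing_term (f : fsum C) (a b : C) (km : int * int) : C :=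
  if (0 < km.1) && (km.2 <= 0) then pairing_term f a b km
  else if (km.1 <= 0) && (0 < km.2) then - pairing_term f a b km else 0.

Lemma pairing_term_fadj f a b k m :
  pairing_term (fadj q f) b a (m, k) = pairing_term f a b (k, m).
Proof.
rewrite /pairing_term /fadj /= !qpowM -qpow_add opprB.
have -> : m + (k - m) = k by ring.
by rewrite mulrAC.
Qed.

Lemma signed_pairing_term_fadj f a b k m :
  signed_pairing_term (fadj q f) b a (m, k) = - signed_pairing_term f a b (k, m).
Proof.
rewrite /signed_pairing_term pairing_term_fadj /= andbC [(m <= 0) && _]andbC.
by case: (leP k 0); case: (leP m 0) => _ _ /=; rewrite ?opprK ?oppr0.
Qed.

(** On this quadrant [m - k] tends to minus infinity off finite sets, so [f (m - k)] becomes small.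
    The power [k > 0] keeps it small, while the roots of [a] stay bounded by [v a + 1]. *)
Lemma vanishing_pairing_term f a b : in_F v q f ->
  vanishing v (fun km : int * int =>
    if (0 < km.1) && (km.2 <= 0) then pairing_term f a b km else 0).
Proof.
move=> fF eps e0.
have a0 := absval_ge0 v a; have b0 := absval_ge0 v b.
have a1 : 0 < v a + 1 by lra.
have b1 : 0 < v b + 1 by lra.
pose d := Num.min 1 (eps / (v a + 1)).
have d0 : 0 < d by rewrite lt_min ltr01 divr_gt0.
have [N fN] := in_F_decay_neg fF (divr_gt0 d0 b1).
exists [seq (k%:Z, - m%:Z) | k <- iota 0 N, m <- iota 0 N] => -[k m] kmN /=.
case: ifP => [/andP[k0 m0]|_]; last by rewrite absval0 ltW.
have [j mk Nj] : exists2 j : nat, m - k = - j%:Z & (N <= j)%N.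
  exists (absz (m - k)); first by lia.
  rewrite leqNgt; apply: contra kmN => mkN; apply/allpairsP.
  exists (`|k|%N, `|m|%N); rewrite !mem_iota /=; split; [lia|lia|].
  by congr (_, _); lia.
rewrite /pairing_term /= absvalM.
have h1 : v (qpow q k (f (m - k) * b)) <= d.
  apply: absval_qpow_pos_le; [exact: ltW|by rewrite ge_min lexx|].
  rewrite absvalM mk.
  apply: le_trans (ler_wpM2r b0 (fN _ Nj)) _.
  by rewrite mulrAC ler_pdivrMr // ler_wpM2l ?ltW //; lra.
have h2 : v (qpow q m a) <= v a + 1 by apply: absval_qpow_neg_le => //; lra.
apply: (@le_trans _ _ (eps / (v a + 1) * (v a + 1))); last first.
  by rewrite divfK // gt_eqF.
apply: ler_pM; rewrite ?absval_ge0 //; apply: le_trans h1 _.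
by rewrite ge_min lexx orbT.
Qed.

Let swap_bij (I J : eqType) : bijective (fun x : I * J => (x.2, x.1)).
Proof. by exists (fun x => (x.2, x.1)) => -[]. Qed.

Lemma vanishing_signed_pairing_term f a b : complete_absval v -> in_F v q f ->
  vanishing v (signed_pairing_term f a b).
Proof.
move=> vC fF; have h1 := vanishing_pairing_term a b fF.
(* The quadrant [k <= 0 < m] is the first one for the adjoint, with [a] and [b] exchanged. *)
have h2 := vanishing_reindex (swap_bij _ _)
  (vanishing_pairing_term b a (in_F_fadj vC fF)).
have := vanishingB h1 h2; congr (vanishing v); apply/funext => -[k m] /=.
rewrite pairing_term_fadj /signed_pairing_term /= [(0 < m) && _]andbC.
by case: (leP k 0); case: (leP m 0) => _ _ /=; rewrite ?subr0 ?sub0r.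
Qed.

(* Row k of the signed array sums to the k-th term of the pairing; for k <= 0
   this uses that the terms with m > 0 sum to minus those with m <= 0. *)
Lemma has_sum_pairing f a b : complete_absval v -> in_F v q f -> fker v q f a ->
  has_sum v (signed_pairing_term f a b) (pairing v q f a b).
Proof.
move=> vC fF fa.
have [l Xl] := vanishing_has_sum vC (vanishing_signed_pairing_term a b vC fF).
suff -> : pairing v q f a b = l by [].
apply: biseriesE; apply: has_sum_fubini Xl _ => k.
have tot := fker_has_sum vC fF fa.
have shift : bijective (fun m : int => m - k).
  by exists (fun m => m + k) => m; rewrite ?subrK ?addrK.
pose t i := f i * qpow q i a.
have tE m : qpow q k (b * t (m - k)) = pairing_term f a b (k, m).
  rewrite /t /pairing_term /= !qpowM -qpow_add.
  have -> : k + (m - k) = m by ring.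
  by rewrite !mulrA [qpow q k b * _]mulrC.
have row u l' : has_sum v u l' ->
    has_sum v (fun m => qpow q k (b * u (m - k))) (qpow q k (b * l')).
  by move=> ul; apply/has_sum_qpow/has_sumZ/(has_sum_reindex shift).
(* The adjoint reads the coefficient at [- k]; after the shift by [k] the cutoff [m - k <= - k]
   becomes [m <= 0], the same for every row. *)
have gk := gquot_has_sum vC fF fa (- k).
rewrite /fadj -qpowM [_ * b]mulrC.
have [k0|k0] := ltP 0 k.
  apply: has_sum_ext (row _ _ gk) => m.
  rewrite /signed_pairing_term /= k0 /= -tE [k <= 0]leNgt k0 /=.
  have -> : (m - k <= - k) = (m <= 0) by lia.
  by case: ifP; rewrite // mulr0 qpow0n.
have := has_sumN (row _ _ (has_sum_restrictC tot gk)).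
rewrite mulrN qpowN opprK; apply: has_sum_ext => m.
rewrite /signed_pairing_term /= k0 [0 < k]ltNge k0 /= -tE.
have -> : (m - k <= - k) = (m <= 0) by lia.
by case: leP; rewrite // mulr0 qpow0n oppr0.
Qed.

Lemma pairing_fadj f a b : complete_absval v -> in_F v q f ->
  fker v q f a -> fker v q (fadj q f) b ->
  pairing v q f a b = - pairing v q (fadj q f) b a.
Proof.
move=> vC fF fa fb; apply: has_sum_unique (has_sum_pairing b vC fF fa) _.
have := has_sum_pairing a vC (in_F_fadj vC fF) fb.
move=> /(has_sum_reindex (swap_bij _ _)) /has_sumN; apply: has_sum_ext => -[k m] /=.
by rewrite signed_pairing_term_fadj opprK.
Qed.

End FormalSums.

Theorem proposition8p5 (p e q : nat) (p_prime : prime p) (e_gt0 : (0 < e)%N)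
  (q_def : q = (p ^ e)%N)
  (Fq : finFieldType) (card_Fq : #|Fq| = q)
  (C : closedFieldType) (iota : {rmorphism Fq -> C})
  (R : realType) (v : nonarch_absval R C) (v_complete : complete_absval v)
  (f : fsum C) (fF : in_F v q f) (f_neq0 : f <> fconst 0)
  (alpha beta : C) (ker_alpha : fker v q f alpha)
  (ker_beta : fker v q (fadj q f) beta) :
  pairing v q f alpha beta = - pairing v q (fadj q f) beta alpha.
Proof.
apply: pairing_fadj => //.
(* The characteristic is read off the finite field embedded in [C]. *)
have p_pchar : p \in [pchar C].
  rewrite (fmorph_pchar iota); apply: (@card_finPcharP _ _ e) => //.
  by rewrite card_Fq.
by rewrite q_def pnatX (eq_pnat _ (pcharf_eq p_pchar)) pnat_id.
Qed.
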